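(* Let $H$ be a weighted graph. Then the graph parameter $f_H$, given by $f_H(G)=\hom(G,H)$, is reflection positive, and $r_{f_H}(k)\le |V(H)|^k$ for every integer $k\ge 0$.
   Context: Graphs $G$ are finite, may have multiple (parallel) edges, but have no loops. The graph with no nodes and no edges is allowed. A graph parameter is a real-valued function $f$ on finite graphs that is invariant under graph isomorphism. A $k$-labeled graph ($k\ge 0$) is a finite graph in which $k$ distinct nodes are labeled by $1,2,\dots,k$ (each label used exactly once); there can be any number of unlabeled nodes. Two $k$-labeled graphs are isomorphic if there is a label-preserving isomorphism between them. The product $G_1G_2$ of two $k$-labeled graphs is obtained by taking their disjoint union and identifying nodes with the same label, keeping all edges (so edges between labeled nodes coming from both graphs become parallel edges). For $k=0$ it is the disjoint union. For a graph parameter $f$ and integer $k\ge 0$, the connection matrix $M(f,k)$ is the infinite matrix whose rows and columns are indexed by isomorphism types of $k$-labeled graphs, and whose entry in row $G_1$ and column $G_2$ is $f(G_1G_2)$ (the value of $f$ on the underlying unlabeled graph). Let $r_f(k)$ denote the rank of $M(f,k)$ (possibly infinite). The parameter $f$ is reflection positive if $M(f,k)$ is positive semidefinite for every $k\ge 0$, where an infinite symmetric real matrix is positive semidefinite if $x^{T}Mx\ge 0$ for every finitely supported real vector $x$. A weighted graph $H$ is a finite graph with a positive real weight $\alpha_H(i)$ on each node $i$ and a real weight $\beta_H(i,j)$ on each edge $ij$. It is taken to be a complete graph with a loop at every node (missing edges get weight $0$), so $H$ is described by a positive integer $d=|V(H)|$, a positive real vector $(\alpha_1,\dots,\alpha_d)\in\mathbb{R}^d$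 and a real symmetric matrix $(\beta_{ij})\in\mathbb{R}^{d\times d}$. For a graph $G$ define $$\hom(G,H)=\sum_{\phi:V(G)\to V(H)}\ \prod_{u\in V(G)}\alpha_H(\phi(u))\prod_{uv\in E(G)}\beta_H(\phi(u),\phi(v)),$$ where the sum is over all maps $\phi$, parallel edges of $G$ contribute with multiplicity, and empty products equal $1$. *)

(* Defs.v *)
From HB Require Import structures.
From mathcomp Require Import all_boot all_order all_algebra.
From mathcomp Require Import all_classical all_reals all_analysis.

Set Implicit Arguments.
Unset Strict Implicit.
Unset Printing Implicit Defensive.

Import Order.TTheory GRing.Theory Num.Theory.
Local Open Scope ring_scope.
Local Open Scope classical_set_scope.

(* Edges are explicit objects, so parallel edges are allowed. The order of    *)
(* the two endpoints of an edge is irrelevant: isomorphisms may exchange them *)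
Record mgraph : Type := MGraph {
  node : finType;
  edge : finType;
  src : edge -> node;
  tgt : edge -> node;
  loopless : forall e, src e != tgt e }.

Arguments src {m} : rename.
Arguments tgt {m} : rename.

Definition graph_iso_by (G1 G2 : mgraph)
    (h : node G1 -> node G2) (g : edge G1 -> edge G2) : Prop :=
  [/\ bijective h, bijective g &
    forall e, (src (g e) = h (src e) /\ tgt (g e) = h (tgt e)) \/
              (src (g e) = h (tgt e) /\ tgt (g e) = h (src e))].

Definition graph_iso (G1 G2 : mgraph) : Prop :=
  exists h g, @graph_iso_by G1 G2 h g.

Record graph_param (R : realType) : Type := GraphParam {
  gp_fun :> mgraph -> R;
  gp_iso : forall G1 G2, graph_iso G1 G2 -> gp_fun G1 = gp_fun G2 }.

(* Labels range over 'I_k = {0, ..., k-1} instead of {1, ..., k}. *)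
Record lgraph (k : nat) : Type := LGraph {
  lg_graph :> mgraph;
  lab : 'I_k -> node lg_graph;
  lab_inj : injective lab }.

Definition lgraph_iso (k : nat) (G1 G2 : lgraph k) : Prop :=
  exists h g, @graph_iso_by G1 G2 h g /\ forall i, h (lab G1 i) = lab G2 i.

Section Glue.
Variables (k : nat) (G1 G2 : lgraph k).

(* Identifying equally labeled nodes in the disjoint union leaves the nodes   *)
(* of G1 and the unlabeled nodes of G2.                                       *)
Definition glue_node : finType :=
  (node G1 + {v : node G2 | v \notin codom (lab G2)})%type.

Definition glue_in1 (v : node G1) : glue_node := inl v.

Definition glue_in2 (v : node G2) : glue_node :=
  match boolP (v \in codom (lab G2)) with
  | AltTrue labeled => inl (lab G1 (iinv labeled))
  | AltFalse unlabeled => inr (exist _ v unlabeled)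
  end.

Lemma glue_in1_inj : injective glue_in1.
Proof. by move=> x y []. Qed.

Lemma glue_in2_lab i : glue_in2 (lab G2 i) = glue_in1 (lab G1 i).
Proof.
rewrite /glue_in2; case: {-}_ / boolP => [p|/negP[]]; last exact: codom_f.
by congr (inl (lab G1 _)); apply: (@lab_inj _ G2); rewrite f_iinv.
Qed.

Lemma glue_in2_inj : injective glue_in2.
Proof.
move=> x y; rewrite /glue_in2.
case: {-}_ / boolP => p; case: {-}_ / boolP => q // [].
  by move=> /lab_inj e; rewrite -(f_iinv p) -(f_iinv q) e.
by [].
Qed.

Definition glue_edge : finType := (edge G1 + edge G2)%type.

Definition glue_src (e : glue_edge) : glue_node :=
  match e with inl e1 => glue_in1 (src e1) | inr e2 => glue_in2 (src e2) end.

Definition glue_tgt (e : glue_edge) : glue_node :=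
  match e with inl e1 => glue_in1 (tgt e1) | inr e2 => glue_in2 (tgt e2) end.

Lemma glue_loopless e : glue_src e != glue_tgt e.
Proof.
case: e => e /=.
  by rewrite (inj_eq glue_in1_inj) loopless.
by rewrite (inj_eq glue_in2_inj) loopless.
Qed.

Lemma glue_lab_inj : injective (glue_in1 \o lab G1).
Proof. exact: inj_comp glue_in1_inj (@lab_inj _ G1). Qed.

Definition lg_mul : lgraph k :=
  @LGraph k (MGraph glue_loopless) (glue_in1 \o lab G1) glue_lab_inj.

End Glue.

Section GlueMap.
Variables (k : nat) (G1 G2 G1' G2' : lgraph k).

Definition glue_map (h1 : node G1 -> node G1') (h2 : node G2 -> node G2')
    (v : glue_node G1 G2) : glue_node G1' G2' :=
  match v with
  | inl v1 => glue_in1 G2' (h1 v1)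
  | inr v2 => glue_in2 G1' (h2 (val v2))
  end.

Lemma glue_map_in2 h1 h2 (v : node G2) :
  (forall i, h1 (lab G1 i) = lab G1' i) ->
  (forall i, h2 (lab G2 i) = lab G2' i) ->
  glue_map h1 h2 (glue_in2 G1 v) = glue_in2 G1' (h2 v).
Proof.
move=> h1l h2l; rewrite {1}/glue_in2; case: {-}_ / boolP => p //=.
by rewrite -{2}(f_iinv p) h2l h1l glue_in2_lab.
Qed.

End GlueMap.

Lemma glue_mapK (k : nat) (G1 G2 G1' G2' : lgraph k)
    (h1 : node G1 -> node G1') (h2 : node G2 -> node G2') h1' h2' :
  cancel h1 h1' -> cancel h2 h2' ->
  (forall i, h1' (lab G1' i) = lab G1 i) ->
  (forall i, h2' (lab G2' i) = lab G2 i) ->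
  cancel (glue_map h1 h2) (glue_map h1' h2').
Proof.
move=> h1K h2K h1'l h2'l [v|[v vP]] /=; first by rewrite h1K.
rewrite glue_map_in2 // h2K /glue_in2.
case: {-}_ / boolP => p; first by case/negP: vP.
by congr inr; apply: val_inj.
Qed.

Lemma lg_mul_iso (k : nat) (G1 G2 G1' G2' : lgraph k) :
  lgraph_iso G1 G1' -> lgraph_iso G2 G2' ->
  lgraph_iso (lg_mul G1 G2) (lg_mul G1' G2').
Proof.
case=> h1 [g1 [[[h1' h1K h1'K] [g1' g1K g1'K] e1] l1]].
case=> h2 [g2 [[[h2' h2K h2'K] [g2' g2K g2'K] e2] l2]].
have l1' i : h1' (lab G1' i) = lab G1 i by rewrite -l1 h1K.
have l2' i : h2' (lab G2' i) = lab G2 i by rewrite -l2 h2K.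
exists (glue_map h1 h2 : node (lg_mul G1 G2) -> node (lg_mul G1' G2')).
exists ((fun e => match e with inl e => inl (g1 e) | inr e => inr (g2 e) end)
  : edge (lg_mul G1 G2) -> edge (lg_mul G1' G2')).
split; last by move=> i /=; rewrite l1.
split.
- by exists (glue_map h1' h2'); apply: glue_mapK.
- exists (fun e => match e with inl e => inl (g1' e) | inr e => inr (g2' e) end).
    by case=> e; rewrite ?g1K ?g2K.
  by case=> e; rewrite ?g1'K ?g2'K.
- case=> e /=.
    by case: (e1 e) => -[-> ->]; [left|right].
  by rewrite !glue_map_in2 //; case: (e2 e) => -[-> ->]; [left|right].
Qed.

Definition iso_type (k : nat) : Type :=
  {C : lgraph k -> Prop | exists G, C = lgraph_iso G}.

Definition iso_repr (k : nat) (C : iso_type k) : lgraph k :=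
  projT1 (cid (svalP C)).

(* Since f is isomorphism-invariant, the entries do not depend on the         *)
(* representatives; see conn_mxE below.                                       *)
Definition conn_mx (R : realType) (f : graph_param R) (k : nat)
    (C1 C2 : iso_type k) : R :=
  f (lg_mul (iso_repr C1) (iso_repr C2)).

Definition iso_class (k : nat) (G : lgraph k) : iso_type k :=
  exist _ (lgraph_iso G) (ex_intro _ G erefl).

Lemma conn_mxE (R : realType) (f : graph_param R) (k : nat)
    (G1 G2 : lgraph k) :
  conn_mx f (iso_class G1) (iso_class G2) = f (lg_mul G1 G2).
Proof.
have repr_iso (G : lgraph k) : lgraph_iso G (iso_repr (iso_class G)).
  rewrite /iso_repr; case: cid => G' /= ->.
  exists id, id; split=> //; split; [by exists id | by exists id |].
  by move=> e; left.
have [h [g [hg _]]] := lg_mul_iso (repr_iso G1) (repr_iso G2).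
by rewrite /conn_mx; symmetry; apply: gp_iso; exists h, g.
Qed.

(* A finitely supported vector is given by finitely many distinct indices s   *)
(* together with its values x at these indices.                               *)
Definition psd (R : realType) (I : Type) (M : I -> I -> R) : Prop :=
  (forall i j, M i j = M j i) /\
  forall (n : nat) (s : 'I_n -> I) (x : 'I_n -> R), injective s ->
    0 <= \sum_(i < n) \sum_(j < n) x i * M (s i) (s j) * x j.

Definition rows_free (R : realType) (I : Type) (M : I -> I -> R)
    (n : nat) (s : 'I_n -> I) : Prop :=
  forall c : 'I_n -> R,
    (forall j : I, \sum_(i < n) c i * M (s i) j = 0) -> forall i, c i = 0.

(* The supremum of the numbers of linearly independent rows, possibly +oo.    *)
Definition imx_rank (R : realType) (I : Type) (M : I -> I -> R) : \bar R :=
  ereal_sup [set (n%:R)%:E | n in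
    [set n : nat | exists s : 'I_n -> I, rows_free M s]].

Definition conn_rank (R : realType) (f : graph_param R) (k : nat) : \bar R :=
  imx_rank (conn_mx f (k := k)).

Definition reflection_positive (R : realType) (f : graph_param R) : Prop :=
  forall k : nat, psd (conn_mx f (k := k)).

Record wgraph (R : realType) : Type := WGraph {
  wsize : nat;
  wsize_gt0 : (0 < wsize)%N;
  alpha : 'I_wsize -> R;
  alpha_gt0 : forall i, 0 < alpha i;
  beta : 'M[R]_wsize;
  beta_sym : forall i j, beta i j = beta j i }.

Definition hom (R : realType) (G : mgraph) (H : wgraph R) : R :=
  \sum_(phi : {ffun node G -> 'I_(wsize H)})
    (\prod_(u : node G) alpha (phi u)) *
    (\prod_(e : edge G) beta H (phi (src e)) (phi (tgt e))).

Lemma hom_iso (R : realType) (H : wgraph R) (G1 G2 : mgraph) :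
  graph_iso G1 G2 -> hom G1 H = hom G2 H.
Proof.
case=> h [g [[h' hK h'K] bij_g hg]]; rewrite /hom.
rewrite (reindex (fun phi : {ffun node G2 -> 'I_(wsize H)} =>
    [ffun u => phi (h u)])) /=; last first.
  exists (fun phi : {ffun node G1 -> 'I_(wsize H)} => [ffun u => phi (h' u)]).
    by move=> phi _; apply/ffunP => u; rewrite !ffunE h'K.
  by move=> phi _; apply/ffunP => u; rewrite !ffunE hK.
apply: eq_bigr => phi _; congr (_ * _).
  rewrite [RHS](reindex h) /=; last by exists h' => x _.
  by apply: eq_bigr => u _; rewrite ffunE.
rewrite [RHS](reindex g) /=; last exact: onW_bij.
apply: eq_bigr => e _; rewrite !ffunE.
by case: (hg e) => -[-> ->] //; rewrite beta_sym.
Qed.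

Definition hom_param (R : realType) (H : wgraph R) : graph_param R :=
  GraphParam (@hom_iso R H).

(* Main.v *)
(* Summing over the maps V(G) -> V(H) that extend a fixed map phi of the      *)
(* labels, and leaving out the node weights of the labeled nodes, gives a     *)
(* partial homomorphism function G |-> hom_phi(G) which is multiplicative on  *)
(* products of k-labeled graphs. Therefore                                    *)
(*   hom(G1 G2, H) = \sum_phi alpha_phi * hom_phi(G1) * hom_phi(G2),          *)
(* where phi ranges over the |V(H)|^k maps of the labels and alpha_phi > 0 is *)
(* the product of the weights of the phi(i): the connection matrix is a       *)
(* nonnegative combination of |V(H)|^k rank-one squares.                      *)
Require Import Defs.
From HB Require Import structures.
From mathcomp Require Import all_boot all_order all_algebra.
From mathcomp Require Import all_classical all_reals all_analysis.

Import Order.TTheory GRing.Theory Num.Theory.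

Local Open Scope ring_scope.

(** A map from the product of [G1] and [G2] to [H] is a pair of maps from [G1] and [G2] that agree
    on the labels. Grouping such maps by their common values [phi] on the labels makes each entry a
    sum over [phi] of a positive weight times a product of a factor from [G1] and one from [G2]
    ([hom_lg_mul]). Any matrix of this form is positive semidefinite ([psd_sum_squares]), with rank
    at most the number of terms ([imx_rank_sum_squares]). *)

Section SumOfSquares.
Variables (R : realType) (I : Type) (P : finType).
Variables (M : I -> I -> R) (a : P -> R) (v : I -> P -> R).
Hypothesis ME : forall i j, M i j = \sum_p a p * (v i p * v j p).

(** The quadratic form of [M] at [x] is the sum over [p] of [a p] times the square of
    [\sum_i x i * v (s i) p]. *)
Lemma psd_sum_squares : (forall p, 0 <= a p) -> psd M.
Proof.
move=> a_ge0; split=> [i j|n s x _].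
  by rewrite !ME; apply: eq_bigr => p _; rewrite [v i p * _]mulrC.
suff -> : \sum_(i < n) \sum_(j < n) x i * M (s i) (s j) * x j =
    \sum_p a p * (\sum_(i < n) x i * v (s i) p) ^+ 2.
  by apply: sumr_ge0 => p _; rewrite mulr_ge0 ?sqr_ge0.
transitivity (\sum_p \sum_(i < n) \sum_(j < n)
    a p * (x i * v (s i) p * (x j * v (s j) p))); last first.
  apply: eq_bigr => p _; rewrite expr2 big_distrlr mulr_sumr.
  by apply: eq_bigr => i _; rewrite mulr_sumr.
rewrite [RHS]exchange_big; apply: eq_bigr => i _ /=.
rewrite [RHS]exchange_big; apply: eq_bigr => j _ /=.
rewrite ME mulr_sumr mulr_suml; apply: eq_bigr => p _.
by rewrite mulrCA -!mulrA [v (s j) p * x j]mulrC.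
Qed.

(** Rows of [M] factor through the vectors [v (s i)] in a space of dimension [#|P|]: a linear
    relation among these vectors is also one among the rows, so independent rows force independent
    vectors. *)
Lemma rows_free_sum_squares (n : nat) (s : 'I_n -> I) :
  rows_free M s -> (n <= #|P|)%N.
Proof.
move=> freeM.
pose A : 'M[R]_(n, #|P|) := \matrix_(i, q) v (s i) (enum_val q).
suff /eqP <- : row_free A by exact: rank_leq_col.
rewrite -kermx_eq0; apply/rowV0P => c /sub_kermxP cA0.
apply/rowP => i; rewrite mxE; move: i; apply: freeM => j.
under eq_bigr => i _ do rewrite ME mulr_sumr.
rewrite exchange_big big1 // => p _ /=.
transitivity (a p * v j p * (c *m A) 0 (enum_rank p)).
  rewrite mxE mulr_sumr; apply: eq_bigr => i _.
  rewrite mxE enum_rankK mulrCA -[RHS]mulrA; congr (_ * _).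
  by rewrite [RHS]mulrCA [v j p * _]mulrC.
by rewrite cA0 mxE mulr0.
Qed.

Lemma imx_rank_sum_squares : (imx_rank M <= (#|P|%:R)%:E)%E.
Proof.
apply: ge_ereal_sup => _ [n [s /rows_free_sum_squares n_le] <-].
by rewrite lee_fin ler_nat.
Qed.

End SumOfSquares.

Lemma glue_in2_unlabeled (k : nat) (G1 G2 : lgraph k)
    (u : {v : node G2 | v \notin codom (lab G2)}) :
  glue_in2 G1 (val u) = inr u.
Proof.
rewrite /glue_in2; case: u => u uP /=; case: {-}_ / boolP => p.
  by case/negP: uP.
by congr inr; apply: val_inj.
Qed.

Section PartialHom.
Variables (R : realType) (H : wgraph R) (k : nat).
Implicit Types (G : lgraph k) (phi : {ffun 'I_k -> 'I_(wsize H)}).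

Definition restrict_lab G (psi : {ffun node G -> 'I_(wsize H)}) :
  {ffun 'I_k -> 'I_(wsize H)} := [ffun i => psi (lab G i)].

(** Labeled nodes of two factors are identified in the product; their weights are left to
    [lab_weight] so as to be counted once. *)
Definition hom_weight G (psi : {ffun node G -> 'I_(wsize H)}) : R :=
  (\prod_(u : node G | u \notin codom (lab G)) alpha (psi u)) *
  (\prod_(e : edge G) beta H (psi (src e)) (psi (tgt e))).

Definition partial_hom G phi : R :=
  \sum_(psi : {ffun node G -> 'I_(wsize H)} | restrict_lab G psi == phi)
    hom_weight G psi.

Definition lab_weight phi : R := \prod_(i < k) alpha (phi i).

Definition restrict1 {G1 G2} (psi : {ffun glue_node G1 G2 -> 'I_(wsize H)}) :
  {ffun node G1 -> 'I_(wsize H)} := [ffun u => psi (glue_in1 G2 u)].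

Definition restrict2 {G1 G2} (psi : {ffun glue_node G1 G2 -> 'I_(wsize H)}) :
  {ffun node G2 -> 'I_(wsize H)} := [ffun u => psi (glue_in2 G1 u)].

(** Labeled nodes take their value from [psi1], which makes the gluing total; it extends [psi2] only
    if both maps agree on the labels. *)
Definition glue_fun {G1 G2} (psi1 : {ffun node G1 -> 'I_(wsize H)})
    (psi2 : {ffun node G2 -> 'I_(wsize H)}) :
  {ffun glue_node G1 G2 -> 'I_(wsize H)} :=
  [ffun u => match u with inl u1 => psi1 u1 | inr u2 => psi2 (val u2) end].

Lemma restrictK G1 G2 (psi : {ffun glue_node G1 G2 -> 'I_(wsize H)}) :
  glue_fun (restrict1 psi) (restrict2 psi) = psi.
Proof.
by apply/ffunP => -[u|u]; rewrite !ffunE // glue_in2_unlabeled.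
Qed.

Lemma restrict1_glue_fun G1 G2 psi1 psi2 :
  restrict1 (@glue_fun G1 G2 psi1 psi2) = psi1.
Proof. by apply/ffunP => u; rewrite !ffunE. Qed.

Lemma restrict2_glue_fun G1 G2 psi1 psi2 :
  restrict_lab G1 psi1 = restrict_lab G2 psi2 ->
  restrict2 (@glue_fun G1 G2 psi1 psi2) = psi2.
Proof.
move=> /ffunP eq12; apply/ffunP => u; rewrite !ffunE.
case: (boolP (u \in codom (lab G2))) => [/codomP[i ->]|uP].
  by rewrite glue_in2_lab; have := eq12 i; rewrite !ffunE.
by rewrite (glue_in2_unlabeled _ G1 G2 (exist _ u uP)).
Qed.

Lemma restrict_lab1 G1 G2 (psi : {ffun glue_node G1 G2 -> 'I_(wsize H)}) :
  restrict_lab G1 (restrict1 psi) = restrict_lab (lg_mul G1 G2) psi.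
Proof. by apply/ffunP => i; rewrite !ffunE. Qed.

Lemma restrict_lab2 G1 G2 (psi : {ffun glue_node G1 G2 -> 'I_(wsize H)}) :
  restrict_lab G2 (restrict2 psi) = restrict_lab (lg_mul G1 G2) psi.
Proof. by apply/ffunP => i; rewrite !ffunE glue_in2_lab. Qed.

Lemma prod_labeled G (F : node G -> R) :
  \prod_u F u =
  (\prod_(i < k) F (lab G i)) * \prod_(u | u \notin codom (lab G)) F u.
Proof.
rewrite (bigID (mem (codom (lab G)))) /=; congr (_ * _).
rewrite -big_uniq; first by rewrite big_image.
by rewrite map_inj_uniq ?enum_uniq //; exact: lab_inj.
Qed.

(** Nodes of the product split into labeled ones, unlabeled ones of [G1] and unlabeled ones of [G2];
    its edges are the disjoint union. *)
Lemma hom_weight_lg_mul G1 G2 (psi : {ffun node (lg_mul G1 G2) -> 'I_(wsize H)}) :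
  (\prod_(u : node (lg_mul G1 G2)) alpha (psi u)) *
  (\prod_(e : edge (lg_mul G1 G2)) beta H (psi (src e)) (psi (tgt e))) =
  lab_weight (restrict_lab (lg_mul G1 G2) psi) *
  (hom_weight G1 (restrict1 psi) * hom_weight G2 (restrict2 psi)).
Proof.
rewrite !big_sumType /= prod_labeled -!mulrA; congr (_ * _).
  by apply: eq_bigr => i _; rewrite ffunE.
rewrite /hom_weight mulrA mulrACA -mulrA; congr (_ * (_ * (_ * _))).
- by apply: eq_bigr => u _; rewrite ffunE.
- by apply: eq_bigr => e _; rewrite !ffunE.
- rewrite (big_sub [pred v | v \notin codom (lab G2)]).
  by apply: eq_bigr => u _; rewrite ffunE glue_in2_unlabeled.
- by apply: eq_bigr => e _; rewrite !ffunE.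
Qed.

Lemma hom_lg_mul G1 G2 :
  Defs.hom (lg_mul G1 G2) H =
  \sum_phi lab_weight phi * (partial_hom G1 phi * partial_hom G2 phi).
Proof.
rewrite /Defs.hom (partition_big (restrict_lab (lg_mul G1 G2)) predT) //=.
apply: eq_bigr => phi _; rewrite /partial_hom big_distrlr pair_big /= mulr_sumr.
(* Gluing needs to be undone by restriction only on pairs in the range of summation, where both maps
   induce [phi] on the labels. *)
rewrite (reindex_onto (fun psi => (restrict1 psi, restrict2 psi))
  (fun p => glue_fun p.1 p.2)) => [|[psi1 psi2] /= /andP[/eqP e1 /eqP e2]]; last first.
  by rewrite restrict1_glue_fun restrict2_glue_fun // e1 e2.
apply: eq_big => [psi|psi /eqP <-] /=; last exact: hom_weight_lg_mul.
by rewrite restrictK eqxx restrict_lab1 restrict_lab2 andbb andbT.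
Qed.

End PartialHom.

Theorem theorem2p3 (R : realType) (H : wgraph R) :
  reflection_positive (hom_param H) /\
  forall k : nat, (conn_rank (hom_param H) k <= ((wsize H ^ k)%N%:R)%:E)%E.
Proof.
have connE k C1 C2 := hom_lg_mul _ H k (iso_repr C1) (iso_repr C2).
split=> k.
  apply: psd_sum_squares (connE k) _ => phi.
  by apply: prodr_ge0 => i _; exact/ltW/alpha_gt0.
have -> : (wsize H ^ k)%N = #|{ffun 'I_k -> 'I_(wsize H)}|.
  by rewrite card_ffun !card_ord.
exact: imx_rank_sum_squares (connE k).
Qed.
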